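(* Suppose $\mathbb{C}[\mathfrak{n}]=\mathcal{U}(\mathfrak{n})$ is equipped with an $\mathfrak{so}_{2l+1}(\mathbb{C})$-module structure whose restriction to $\mathcal{U}(\mathfrak{n})$ is the (left) multiplication action. Put $x_{i,i}=X_{i,i}\cdot 1$ and $v_i=V_i\cdot 1$ for $1\le i\le l$, and $u_i=U_i\cdot 1$ for $2\le i\le l$. Then there exist $\Phi\in\mathbb{C}[\mathfrak{n}]$ and $C\in\mathbb{C}$ such that $$x_{1,1}=\widetilde{X}_{1,1}(\Phi)+C,\qquad x_{i,i}=\widetilde{X}_{i,i}(\Phi),\quad u_i=\widetilde{U}_i(\Phi),\quad v_i=\widetilde{V}_i(\Phi)\qquad (2\le i\le l),$$ $$v_1=\frac12\Big(\widetilde{X}_{1,1}(\Phi)\frac{\partial}{\partial U_1}+\sum_{j=2}^l\big(\widetilde{V}_j(\Phi)\frac{\partial}{\partial X_{1,j}}+\widetilde{U}_j(\Phi)\frac{\partial}{\partial Y_{1,j}}\big)+\widetilde{V}_1+2C\frac{\partial}{\partial U_1}\Big)(\Phi).$$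
   Context: Let $l\ge 2$ and let $\mathfrak{so}_{2l+1}(\mathbb{C})$ be the Lie algebra of $(2l+1)\times(2l+1)$ complex matrices of block form (block sizes $1,l,l$) $$\begin{pmatrix}0&V&U\\-U^T&X&Y\\-V^T&Z&-X^T\end{pmatrix},\qquad Y=-Y^T,\ Z=-Z^T.$$ With $e_{s,t}$ the matrix units and $1\le i,j\le l$, set $U_i=e_{1,i+l+1}-e_{i+1,1}$, $V_i=e_{1,i+1}-e_{i+l+1,1}$, $X_{i,j}=e_{i+1,j+1}-e_{j+l+1,i+l+1}$, $Y_{i,j}=e_{i+1,j+l+1}-e_{j+1,i+l+1}$, $Z_{i,j}=e_{i+l+1,j+1}-e_{j+l+1,i+1}$. The subalgebra $\mathfrak{n}=\mathrm{span}_{\mathbb{C}}\{U_1,X_{1,j},Y_{1,j}\mid 2\le j\le l\}$ is abelian, so $\mathcal{U}(\mathfrak{n})=\mathbb{C}[\mathfrak{n}]$ is the polynomial algebra in the variables $U_1,X_{1,j},Y_{1,j}$ ($2\le j\le l$). Differential operators on $\mathbb{C}[\mathfrak{n}]$ (products mean composition): $\widetilde{X}_{1,1}=U_1\frac{\partial}{\partial U_1}+\sum_{j=2}^l\big(X_{1,j}\frac{\partial}{\partial X_{1,j}}+Y_{1,j}\frac{\partial}{\partial Y_{1,j}}\big)$; $\widetilde{X}_{j,j}=Y_{1,j}\frac{\partial}{\partial Y_{1,j}}-X_{1,j}\frac{\partial}{\partial X_{1,j}}$ for $2\le j\le l$; $\widetilde{U}_i=Y_{1,i}\frac{\partial}{\partial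 U_1}-U_1\frac{\partial}{\partial X_{1,i}}$ and $\widetilde{V}_i=X_{1,i}\frac{\partial}{\partial U_1}-U_1\frac{\partial}{\partial Y_{1,i}}$ for $2\le i\le l$; $\widetilde{V}_1=\widetilde{X}_{1,1}\frac{\partial}{\partial U_1}+\sum_{j=2}^l\big(\widetilde{V}_j\frac{\partial}{\partial X_{1,j}}+\widetilde{U}_j\frac{\partial}{\partial Y_{1,j}}\big)$. Polynomials such as $\widetilde{X}_{1,1}(\Phi)$ appearing as coefficients of an operator act by multiplication. *)

(* Defs.v *)
From mathcomp Require Import all_boot all_order all_algebra.
From mathcomp Require Import reals complex.
From mathcomp Require Import mpoly.
From mathcomp Require Import zify.

Set Implicit Arguments.
Unset Strict Implicit.
Unset Printing Implicit Defensive.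

Import GRing.Theory.
Local Open Scope ring_scope.

(* The complex numbers are R[i] for a realType R. All indices i, j, s, t are
   natural numbers counted from 1, and only meaningful in their mathematical
   range: 1 <= i, j <= l for the generators of so, 2 <= i, j <= l for
   varX, varY and the operators tX, tU, tV (index 1 has its own tX11, tV1). *)

Section OddOrthogonal.
Variables (R : realType) (l : nat).

Notation C := R[i].
Notation mat := 'M[C]_(1 + (l + l)).

Definition in_so (A : mat) : Prop :=
  exists (U V : 'rV[C]_l) (X Y Z : 'M[C]_l),
    [/\ Y = - Y^T, Z = - Z^T &
        A = block_mx 0          (row_mx V U)
                     (col_mx (- U^T) (- V^T)) (block_mx X Y Z (- X^T))].

Definition lie_bracket (A B : mat) : mat := A *m B - B *m A.

Definition e_ (s t : nat) : mat :=
  \matrix_(a, b) ((a.+1 == s) && (b.+1 == t))%:R.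

Definition matU (i : nat) : mat := e_ 1 (i + l + 1) - e_ (i + 1) 1.
Definition matV (i : nat) : mat := e_ 1 (i + 1) - e_ (i + l + 1) 1.
Definition matX (i j : nat) : mat :=
  e_ (i + 1) (j + 1) - e_ (j + l + 1) (i + l + 1).
Definition matY (i j : nat) : mat :=
  e_ (i + 1) (j + l + 1) - e_ (j + 1) (i + l + 1).

(* Values of [act] outside so are irrelevant. *)
Record so_module (M : lmodType C) (act : mat -> M -> M) : Prop := SoModule {
  so_module_linearr : forall A, in_so A -> linear (act A);
  so_module_linearl : forall (c : C) A B x, in_so A -> in_so B ->
    act (c *: A + B) x = c *: act A x + act B x;
  so_module_bracket : forall A B x, in_so A -> in_so B ->
    act (lie_bracket A B) x = act A (act B x) - act B (act A x)
}.

(* C[n] is the polynomial ring in 2l - 1 variables, numbered (from 0)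
   U_1, X_{1,2}, ..., X_{1,l}, Y_{1,2}, ..., Y_{1,l}. *)
Definition nvars : nat := (l.-1).*2.+1.
Notation Cn := {mpoly C[nvars]}.

Definition idxU : 'I_nvars := ord0.
Definition idxX (j : nat) : 'I_nvars := inord (j - 1).
Definition idxY (j : nat) : 'I_nvars := inord (l + j - 2).

Definition varU : Cn := 'X_idxU.
Definition varX (j : nat) : Cn := 'X_(idxX j).
Definition varY (j : nat) : Cn := 'X_(idxY j).

(* The basis element of n corresponding to the k-th variable; see the lemmas
   nbasisU, nbasisX and nbasisY. *)
Definition nbasis (k : 'I_nvars) : mat :=
  if k == 0 :> nat then matU 1
  else if (k < l)%N then matX 1 k.+1
  else matY 1 (k + 2 - l).

Lemma nbasisU : nbasis idxU = matU 1.
Proof. by []. Qed.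

Lemma nbasisX (j : nat) : (2 <= j <= l)%N -> nbasis (idxX j) = matX 1 j.
Proof.
move=> jl; rewrite /nbasis /idxX inordK; last by lia.
have -> : (j - 1 == 0)%N = false by lia.
have -> : (j - 1 < l)%N by lia.
by congr (matX _ _); lia.
Qed.

Lemma nbasisY (j : nat) : (2 <= j <= l)%N -> nbasis (idxY j) = matY 1 j.
Proof.
move=> jl; rewrite /nbasis /idxY inordK; last by lia.
have -> : (l + j - 2 == 0)%N = false by lia.
have -> : (l + j - 2 < l)%N = false by lia.
by congr (matY _ _); lia.
Qed.

(* The action on M of the enveloping algebra U(n) = C[n] induced by an action
   of n: the monomial m acts as the product of the powers act(b_k)^(m k) over
   the basis elements b_k (which commute, as n is abelian). *)
Definition Un_act (M : lmodType C) (act : mat -> M -> M) (p : Cn) (x : M) : M :=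
  \sum_(m <- msupp p)
    p@_m *: foldr (fun k y => iter (m k) (act (nbasis k)) y) x (enum 'I_nvars).

Definition dU (f : Cn) : Cn := f^`M(idxU).
Definition dX (j : nat) (f : Cn) : Cn := f^`M(idxX j).
Definition dY (j : nat) (f : Cn) : Cn := f^`M(idxY j).

Definition tX11 (f : Cn) : Cn :=
  varU * dU f + \sum_(2 <= j < l.+1) (varX j * dX j f + varY j * dY j f).

Definition tX (j : nat) (f : Cn) : Cn := varY j * dY j f - varX j * dX j f.

Definition tU (i : nat) (f : Cn) : Cn := varY i * dU f - varU * dX i f.

Definition tV (i : nat) (f : Cn) : Cn := varX i * dU f - varU * dY i f.

Definition tV1 (f : Cn) : Cn :=
  tX11 (dU f) + \sum_(2 <= j < l.+1) (tV j (dX j f) + tU j (dY j f)).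

End OddOrthogonal.

Arguments matU R l i : clear implicits.
Arguments matV R l i : clear implicits.
Arguments matX R l i j : clear implicits.
Arguments matY R l i j : clear implicits.

(* Main.v *)
Require Import Defs.
From mathcomp Require Import all_boot all_order all_algebra.
From mathcomp Require Import reals complex.
From mathcomp Require Import mpoly.
From mathcomp Require Import zify ring.

Set Implicit Arguments.
Unset Strict Implicit.
Unset Printing Implicit Defensive.

Import GRing.Theory.
Local Open Scope ring_scope.

(** Give U_1, X_{1,j}, Y_{1,j} (the basis of n) degree 1; then so = g_{-1} +
    g_0 + n, where g_0 is spanned by X_{1,1} and so(2l-1), which contains the
    X_{i,i}, U_i, V_i with i >= 2, and g_{-1} contains V_1.  Since n acts by
    multiplication, commuting A in g_0 past the variables gives
    [act_derivation]: A acts as a derivation D_A, linear in the variables, plus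
    multiplication by a_A = A.1.

    The relation between A and B in g_0 says that A |-> a_A is a 1-cocycle of
    g_0 with values in C[n].  The operator of X_{1,1} is the Euler operator E,
    which is invertible in positive degrees, and this makes the cocycle a
    coboundary there: define Phi by a_{X_{1,1}} = E Phi + C, with C the
    constant term ([euler_onto]).  As [X_{1,1}, A] = 0, the cocycle relation
    reads E a_A = D_A a_{X_{1,1}} = E (D_A Phi), so a_A - D_A Phi is a
    constant.  This constant vanishes when A is a bracket of elements of g_0,
    because the constant term of a_{[A,B]} = D_A a_B - D_B a_A is zero
    ([bracket_const]); X_{i,i}, U_i, V_i are such brackets up to sign.  This is
    [levi_potential].

    For V_1 there is one more level: [V_1, n] lies in g_0, so V_1 acts as a
    second order operator that is known up to multiplication by v_1
    ([second_orderE]).  Its leading part is half of the operator tV1, and the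
    failure of tV1 to be a derivation is twice the symmetric form [pairing
    lowering].  The relation [X_{1,1}, V_1] = - V_1, applied to 1, turns into
    an equation (E + 1) v_1 = (E + 1) w, with w the required expression in Phi
    and C, and E + 1 is injective ([second_order_at1]). *)

(** * Derivations and the Euler operator on polynomials *)

Section PolynomialOperators.
Variables (n : nat) (K : fieldType).
Notation P := {mpoly K[n]}.
Implicit Types (f g : P) (S T D : P -> P).

Lemma linear_at0 S : linear S -> S 0 = 0.
Proof.
by move=> linS; have := linS (-1) 0 0; rewrite scaler0 addr0 scaleN1r addNr.
Qed.

(** Induction on monomials, in the form in which it is used: a linear operator
    is determined by its value at 1 and by how it commutes with multiplication
    by each variable. *)
Lemma linear_eq_vars S T : linear S -> linear T -> S 1 = T 1 ->
  (forall k f, S f = T f -> S ('X_k * f) = T ('X_k * f)) -> S =1 T.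
Proof.
move=> linS linT ST1 STX; elim/mpolyind => [|c m p _ _ IH].
  by rewrite !linear_at0.
rewrite linS linT IH; congr (_ *: _ + _).
have powX k d f : S f = T f -> S ('X_k ^+ d * f) = T ('X_k ^+ d * f).
  move=> STf; elim: d => [|d IHd]; first by rewrite expr0 mul1r.
  by rewrite exprS -mulrA STX.
rewrite mpolyXE_id; elim: (index_enum _) => [|k s IHs].
  by rewrite big_nil.
by rewrite big_cons powX.
Qed.

Definition derivation D : Prop :=
  linear D /\ forall f g, D (f * g) = D f * g + f * D g.

Lemma derivationM D : derivation D ->
  forall f g, D (f * g) = D f * g + f * D g.
Proof. by case. Qed.

Lemma derivationD D : derivation D -> {morph D : f g / f + g}.
Proof. by case=> linD _ f g; rewrite -[f]scale1r linD !scale1r. Qed.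

Lemma derivationB D : derivation D -> {morph D : f g / f - g}.
Proof.
by case=> linD _ f g; rewrite addrC -scaleN1r linD scaleN1r addrC.
Qed.

Lemma derivationC D c : derivation D -> D c%:MP = 0.
Proof.
case=> linD mulD; have D1 : D 1 = 0.
  have := mulD 1 1; rewrite mulr1 mul1r => /eqP.
  by rewrite mulr1 -subr_eq0 opprD addNKr oppr_eq0 => /eqP.
have := linD c 1 0; rewrite !addr0 D1 scaler0 linear_at0 // add0r => <-.
by rewrite -mul_mpolyC mulr1.
Qed.

Lemma derivation_big D (I : finType) (F : I -> P) : derivation D ->
  D (\sum_i F i) = \sum_i D (F i).
Proof.
move=> derD; apply: (big_morph D (derivationD derD)).
by have [linD _] := derD; apply: linear_at0.
Qed.

Lemma derivation_ext D D' : D =1 D' -> derivation D -> derivation D'.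
Proof.
move=> DD' [linD mulD]; split=> [c f g|f g]; first by rewrite -!DD' linD.
by rewrite -!DD' mulD.
Qed.

Lemma derivation_mderiv (k : 'I_n) : derivation (mderiv k).
Proof. by split; [apply: linearP | apply: mderivM]. Qed.

Lemma derivation_mul (p : P) D : derivation D -> derivation (fun f => p * D f).
Proof.
case=> linD mulD; split=> [c f g|f g]; first by rewrite linD mulrDr scalerAr.
by rewrite mulD mulrDr !mulrA [p * f]mulrC.
Qed.

Lemma derivation_sub D D' :
  derivation D -> derivation D' -> derivation (fun f => D f - D' f).
Proof.
case=> linD mulD [linD' mulD']; split=> [c f g|f g].
  by rewrite linD linD' scalerBr opprD addrACA.
by rewrite mulD mulD' mulrBl mulrBr opprD addrACA.
Qed.

Lemma derivation_sum (I : finType) (D : I -> P -> P) :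
  (forall i, derivation (D i)) -> derivation (fun f => \sum_i D i f).
Proof.
move=> derD; split=> [c f g|f g].
  rewrite scaler_sumr -big_split; apply: eq_bigr => i _ /=.
  by have [-> _] := derD i.
rewrite mulr_suml mulr_sumr -big_split; apply: eq_bigr => i _ /=.
by have [_ ->] := derD i.
Qed.

Lemma mderiv_var (i k : 'I_n) : ('X_k : P)^`M(i) = (k == i)%:R.
Proof.
rewrite mderivX mnm1E; case: eqP => [<-|_]; last by rewrite scale0r.
have -> : (U_(k) - U_(k) = 0)%MM by apply/mnmP => j; rewrite !mnmE subnn.
by rewrite scale1r mpolyX0.
Qed.

Definition euler f : P := \sum_k 'X_k * f^`M(k).

Lemma derivation_euler : derivation euler.
Proof.
by apply: derivation_sum => k; apply/derivation_mul/derivation_mderiv.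
Qed.

Lemma eulerX (k : 'I_n) : euler 'X_k = 'X_k.
Proof.
rewrite /euler (bigD1 k) //= mderiv_var eqxx mulr1 big1 ?addr0 // => i.
by rewrite mderiv_var eq_sym => /negPf->; rewrite mulr0.
Qed.

(** Euler's identity: monomials are eigenvectors, their degree being the
    eigenvalue. *)
Lemma mcoeff_euler f m : (euler f)@_m = (mdeg m)%:R * f@_m.
Proof.
have linE : linear euler by case: derivation_euler.
elim/mpolyind: f => [|c m' p _ _ IH].
  by rewrite linear_at0 // mcoeff0 mulr0.
rewrite linE !mcoeffD IH !mcoeffZ mulrDr; congr (_ + _).
have -> : euler 'X_[m'] = (mdeg m')%:R *: 'X_[m'].
  rewrite /euler mdegE natr_sum scaler_suml; apply: eq_bigr => k _.
  rewrite mderivX -scalerAr -mpolyXD.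
  have [->|mk] := posnP (m' k); first by rewrite !scale0r.
  rewrite addmC submK //; apply/mnm_lepP => i; rewrite mnm1E.
  by case: eqP => // <-.
rewrite mcoeffZ mcoeffX; case: eqP => [->|_]; first by ring.
by rewrite !mulr0.
Qed.

Lemma mcoeff0M f g : (f * g)@_0%MM = f@_0%MM * g@_0%MM.
Proof. exact: (rmorphM (mcoeff 0%MM)). Qed.

Lemma euler_mderiv k f : (euler f)^`M(k) = euler f^`M(k) + f^`M(k).
Proof.
apply/mpolyP => m; rewrite mcoeffD !mcoeff_euler !mcoeff_deriv mcoeff_euler.
by rewrite mdegD mdeg1 -mulrnAr natrD mulrDl mul1r.
Qed.

(** Commuting with the Euler operator means preserving the degree, which for a
    derivation need only be checked on the variables. *)
Lemma euler_commute D f : derivation D ->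
  (forall k, euler (D 'X_k) = D 'X_k) -> euler (D f) = D (euler f).
Proof.
move=> derD EDX; have derE := derivation_euler.
case: (derD) => linD mulD; case: (derE) => linE mulE.
apply: (linear_eq_vars (S := fun f => euler (D f)) (T := fun f => D (euler f))).
- by move=> c g h; rewrite linD linE.
- by move=> c g h; rewrite linE linD.
- by rewrite !(derivationC 1) ?(derivationC 0).
move=> k g IH; rewrite mulD mulE !(derivationD derD) !(derivationD derE).
by rewrite !mulD !mulE EDX eulerX IH; ring.
Qed.

(** The vector fields by which the X_{i,i}, U_i and V_i act are all of this
    shape: each is an infinitesimal rotation for the quadratic form that
    so(2l-1) preserves on n. *)
Definition rotation (a b c d : 'I_n) f : P :=
  'X_a * f^`M(b) - 'X_c * f^`M(d).

Lemma derivation_rotation a b c d : derivation (rotation a b c d).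
Proof.
by apply: derivation_sub; apply/derivation_mul/derivation_mderiv.
Qed.

Lemma rotation_const a b c d f : (rotation a b c d f)@_0%MM = 0.
Proof. by rewrite mcoeffB !mcoeff0M !mcoeffX !mnm1_eq0 !mul0r subr0. Qed.

Lemma euler_rotation a b c d f :
  euler (rotation a b c d f) = rotation a b c d (euler f).
Proof.
apply: (euler_commute _ (derivation_rotation a b c d)) => k.
have [_ mulE] := derivation_euler.
have EX (i j : 'I_n) (x : bool) : euler ('X_i * x%:R) = 'X_i * x%:R.
  rewrite mulE eulerX -[x%:R](rmorph_nat (@mpolyC _ _)).
  by rewrite (derivationC _ derivation_euler) mulr0 addr0.
by rewrite /rotation !mderiv_var (derivationB derivation_euler) !EX.
Qed.

(** * Second order operators built from a family of derivations *)

Section Contraction.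
Variable L : 'I_n -> P -> P.
Hypothesis derL : forall k, derivation (L k).
Hypothesis eulerL : forall k f, euler (L k f) = L k (euler f).

(** This form measures how far [contraction] is from being a derivation:
    contraction (f g) - f (contraction g) - g (contraction f) is
    pairing f g + pairing g f. *)
Definition pairing f g : P := \sum_k L k f * g^`M(k).

Definition contraction f : P := \sum_k L k f^`M(k).

Hypothesis pairingC : forall f g, pairing f g = pairing g f.

Lemma pairing_var f k : pairing f 'X_k = L k f.
Proof.
rewrite /pairing (bigD1 k) //= mderiv_var eqxx mulr1 big1 ?addr0 // => m.
by rewrite mderiv_var eq_sym => /negPf->; rewrite mulr0.
Qed.

Lemma derivation_pairing f : derivation (pairing f).
Proof.
by apply: derivation_sum => k; apply/derivation_mul/derivation_mderiv.
Qed.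

Lemma linear_contraction : linear contraction.
Proof.
move=> c f g; rewrite /contraction scaler_sumr -big_split.
by apply: eq_bigr => k _ /=; have [linL _] := derL k; rewrite linearP linL.
Qed.

Lemma contraction1 : contraction 1 = 0.
Proof.
by rewrite /contraction big1 // => k _; rewrite mderivC (derivationC 0).
Qed.

(** The factor 2 comes from the symmetry of [pairing]: the derivation and the
    partial derivative of each summand of [contraction] may both hit the
    variable. *)
Lemma contraction_var_mul k f :
  contraction ('X_k * f) = 'X_k * contraction f + L k f *+ 2.
Proof.
have -> : L k f *+ 2 = pairing 'X_k f + pairing f 'X_k.
  by rewrite mulr2n pairingC !pairing_var.
rewrite addrC mulr_sumr -!big_split; apply: eq_bigr => m _ /=.
have mulL := derivationM (derL m).
rewrite mderivM (derivationD (derL m)) !mulL mderiv_var.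
rewrite -[(k == m)%:R](rmorph_nat (@mpolyC _ _)) (derivationC _ (derL m)).
by ring.
Qed.

(** [contraction] lowers the degree by one, and so does [pairing] below; this is
    what lets E + 1 be cancelled in the formula for v_1. *)
Lemma contraction_euler f :
  contraction (euler f) = euler (contraction f) + contraction f.
Proof.
rewrite /contraction (derivation_big _ derivation_euler) -big_split.
by apply: eq_bigr => k _ /=; rewrite euler_mderiv (derivationD (derL k)) eulerL.
Qed.

Lemma pairing_euler f :
  pairing f (euler f) *+ 2 = euler (pairing f f) + pairing f f.
Proof.
rewrite mulr2n {1}pairingC /pairing (derivation_big _ derivation_euler).
rewrite -!big_split; apply: eq_bigr => k _ /=.
have [_ ->] := derivation_euler.
by rewrite euler_mderiv eulerL; ring.
Qed.

End Contraction.

End PolynomialOperators.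

(** * Inverting the Euler operator *)

Section EulerInversion.
Variables (n : nat) (K : numFieldType).
Notation P := {mpoly K[n]}.

Lemma euler_eq0 (f : P) : euler f = 0 -> f = (f@_0%MM)%:MP.
Proof.
move=> Ef; apply/mpolyP => m; rewrite mcoeffC.
have [->|m0] := eqVneq m 0%MM; first by rewrite mulr1.
move/(congr1 (mcoeff m)): Ef; rewrite mcoeff_euler mcoeff0 mulr0.
by move/eqP; rewrite mulf_eq0 Num.Theory.pnatr_eq0 mdeg_eq0 (negPf m0) => /eqP.
Qed.


Lemma euler_succ_inj (f g : P) : euler f + f = euler g + g -> f = g.
Proof.
move=> Efg; apply/mpolyP => m; move/(congr1 (mcoeff m)): Efg.
rewrite !mcoeffD !mcoeff_euler -{2}[f@_m]mul1r -{2}[g@_m]mul1r -!mulrDl natr1.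
by move/mulfI; apply; rewrite Num.Theory.pnatr_eq0.
Qed.

Lemma euler_onto (f : P) : exists g, f = euler g + (f@_0%MM)%:MP.
Proof.
(* At m = 0 the quotient is a division by 0, with value 0. *)
exists (\sum_(m <- msupp f) (f@_m / (mdeg m)%:R) *: 'X_[m]).
apply/mpolyP => m; rewrite mcoeffD mcoeff_euler mcoeffC.
have -> : (\sum_(m' <- msupp f) (f@_m' / (mdeg m')%:R) *: 'X_[m'])@_m =
    f@_m / (mdeg m)%:R.
  rewrite [in RHS](mpolyE f) !(raddf_sum (mcoeff m)) mulr_suml.
  apply: eq_bigr => m' _ /=.
  rewrite !mcoeffZ mcoeffX; case: eqP => [->|_]; first by rewrite !mulr1.
  by rewrite !mulr0 mul0r.
have [->|m0] := eqVneq m 0%MM; first by rewrite mdeg0 mul0r add0r mulr1.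
by rewrite mulr0 addr0 mulrC divfK // Num.Theory.pnatr_eq0 mdeg_eq0.
Qed.

(** * A second order operator determined by its commutators *)

(** The operator S stands for the action of V_1, and the commutator of S with
    the k-th variable for the action of [V_1, n_k], an element of g_0: the
    derivation L k plus multiplication by its value at 1.  That value is
    L k Phi, except for X_{1,1} = [V_1, U_1], which has the extra constant c;
    hence the distinguished index j. *)
Section SecondOrder.
Variable L : 'I_n -> P -> P.
Hypothesis derL : forall k, derivation (L k).
Hypothesis eulerL : forall k f, euler (L k f) = L k (euler f).
Hypothesis pairingC : forall f g, pairing L f g = pairing L g f.
Variables (S : P -> P) (Phi : P) (c : K) (j : 'I_n).
Hypothesis linS : linear S.
Hypothesis S_var_mul : forall k f,
  S ('X_k * f) = 'X_k * S f + L k f + f * (L k Phi + (k == j)%:R * c%:MP).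

Let half := (2^-1)%:MP : P.

Let halfK (g : P) : half * (g *+ 2) = g.
Proof.
rewrite mul_mpolyC -scaler_nat scalerA mulVf ?scale1r //.
by rewrite Num.Theory.pnatr_eq0.
Qed.

Lemma second_orderE f :
  S f = 2^-1 *: contraction L f + pairing L Phi f + c%:MP * f^`M(j) + f * S 1.
Proof.
have derphi := derivation_pairing L Phi; have [linphi mulphi] := derphi.
have lincon := linear_contraction derL.
move: f; apply: (linear_eq_vars (T := fun f =>
  2^-1 *: contraction L f + pairing L Phi f + c%:MP * f^`M(j) + f * S 1)) => //.
- by move=> a g h; rewrite lincon linphi mderivD mderivZ -!mul_mpolyC; ring.
- by rewrite contraction1 // (derivationC 1 derphi) mderivC -mul_mpolyC; ring.
move=> k g IH; rewrite S_var_mul IH contraction_var_mul // mulphi mderivM.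
rewrite pairing_var // mderiv_var -!mul_mpolyC -/half.
by rewrite [half * (_ + _ *+ 2)]mulrDr halfK; ring.
Qed.

(** The hypothesis is the relation [X_{1,1}, V_1] = - V_1 evaluated at 1.  After
    the expansion of its left-hand side by [second_orderE], the unknown term
    S 1 * (euler Phi + c) cancels and everything left is in the image of
    E + 1. *)
Lemma second_order_at1 :
    S (euler Phi + c%:MP) = euler (S 1) + S 1 * (euler Phi + c%:MP) + S 1 ->
  S 1 = 2^-1 *: (pairing L Phi Phi + contraction L Phi + (2 * c) *: Phi^`M(j)).
Proof.
set a := euler Phi + c%:MP => weight.
have derphi := derivation_pairing L Phi.
have derE := derivation_euler n K; have mulE := derivationM derE.
have lincon := linear_contraction derL.
have Sa : S a = half * (euler (contraction L Phi) + contraction L Phi)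
    + half * (euler (pairing L Phi Phi) + pairing L Phi Phi)
    + c%:MP * (euler Phi^`M(j) + Phi^`M(j)) + a * S 1.
  rewrite second_orderE -contraction_euler // -pairing_euler // halfK.
  rewrite -euler_mderiv /a (derivationD derphi) (derivationC _ derphi) addr0.
  rewrite mderivD mderivC addr0 -mul_mpolyC -/half; congr (_ * _ + _ + _ + _).
  have := lincon c 1 (euler Phi); rewrite contraction1 // scaler0 add0r => <-.
  by rewrite addrC -mul_mpolyC mulr1.
have -> : 2^-1 *: (pairing L Phi Phi + contraction L Phi + (2 * c) *: Phi^`M(j))
    = half * (pairing L Phi Phi + contraction L Phi) + c%:MP * Phi^`M(j).
  by rewrite scalerDr scalerA mulKf ?Num.Theory.pnatr_eq0 // -!mul_mpolyC.
apply: euler_succ_inj.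
rewrite (derivationD derE) !mulE (derivationD derE) !(derivationC _ derE).
transitivity (S a - S 1 * a); first by rewrite weight; ring.
by rewrite Sa; ring.
Qed.

End SecondOrder.

End EulerInversion.

(** * Brackets in the odd orthogonal Lie algebra *)

Section SkewUnits.
Variables (R : realType) (l : nat).
Implicit Types (i j s t u v : nat).
Notation e := (e_ R l).

(** The pairing of basis vectors under the bilinear form that defines so: index
    1 is paired with itself, and i+1 with i+l+1. *)
Definition mirror s : nat :=
  if s == 1%N then 1%N else if (s <= l.+1)%N then (s + l)%N else (s - l)%N.

Lemma mirror1 : mirror 1 = 1%N. Proof. by []. Qed.

Lemma mirror_low i : (1 <= i <= l)%N -> mirror (i + 1) = (i + l + 1)%N.
Proof. by rewrite /mirror; do 2?case: ifP; lia. Qed.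

Lemma mirror_high i : (1 <= i <= l)%N -> mirror (i + l + 1) = (i + 1)%N.
Proof. by rewrite /mirror; do 2?case: ifP; lia. Qed.

Lemma mirror_range s :
  (1 <= s <= l + l + 1)%N -> (1 <= mirror s <= l + l + 1)%N.
Proof. by rewrite /mirror; do 2?case: ifP; lia. Qed.

Lemma mirrorK s : (1 <= s <= l + l + 1)%N -> mirror (mirror s) = s.
Proof. by rewrite /mirror; do 4?case: ifP; lia. Qed.

Lemma mirror_eq s t : (1 <= s <= l + l + 1)%N -> (1 <= t <= l + l + 1)%N ->
  (mirror s == t) = (s == mirror t).
Proof. by move=> s_r t_r; apply/eqP/eqP => [<-|->]; rewrite mirrorK. Qed.

(** Up to sign, every generator U, V, X, Y of so is of this form, so that a
    single bracket formula covers all of them. *)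
Definition skew s t := e s t - e (mirror t) (mirror s).

Lemma mul_e s t u v : (1 <= t <= l + l + 1)%N ->
  e s t *m e u v = (t == u)%:R *: e s v.
Proof.
move=> t_r; apply/matrixP=> a b; rewrite !mxE.
have t_lt : (t.-1 < 1 + (l + l))%N by lia.
rewrite (bigD1 (Ordinal t_lt)) //= !mxE big1 ?addr0 /= => [|c ne_c].
  rewrite prednK ?eqxx; last by lia.
  by rewrite andbT -!natrM !mulnb andbCA.
rewrite !mxE; have /negPf-> : c.+1 != t; last by rewrite andbF mul0r.
by apply: contraNneq ne_c => ct; apply/eqP/val_inj; rewrite /= -ct.
Qed.

Lemma skew_swap s t : (1 <= s <= l + l + 1)%N -> (1 <= t <= l + l + 1)%N ->
  skew (mirror t) (mirror s) = - skew s t.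
Proof. by move=> s_r t_r; rewrite /skew !mirrorK // opprB. Qed.

Lemma bracket_skew s t u v :
    (1 <= s <= l + l + 1)%N -> (1 <= t <= l + l + 1)%N ->
    (1 <= u <= l + l + 1)%N -> (1 <= v <= l + l + 1)%N ->
  lie_bracket (skew s t) (skew u v) =
    (t == u)%:R *: skew s v - (s == v)%:R *: skew u t
    - (t == mirror v)%:R *: skew s (mirror u)
    + (s == mirror u)%:R *: skew (mirror v) t.
Proof.
move=> s_r t_r u_r v_r; rewrite /lie_bracket /skew !mirrorK //.
rewrite !mulmxBl !mulmxBr !mul_e ?mirror_range //.
have -> : (mirror s == u) = (s == mirror u) by rewrite mirror_eq.
have -> : (mirror s == mirror v) = (s == v).
  by rewrite mirror_eq ?mirror_range ?mirrorK.
have -> : (mirror u == mirror t) = (t == u).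
  by rewrite eq_sym mirror_eq ?mirror_range ?mirrorK.
have -> : (v == mirror t) = (t == mirror v) by rewrite -mirror_eq // eq_sym.
have -> : (v == s) = (s == v) by rewrite eq_sym.
have -> : (mirror u == s) = (s == mirror u) by rewrite eq_sym.
rewrite !scalerBr.
(* The units are generalized so that [mxE] does not unfold their entries. *)
do 8!(move: (_ *: e _ _) => ?).
by apply/matrixP=> a b; rewrite !mxE; ring.
Qed.

Lemma skew_mirror s : (1 <= s <= l + l + 1)%N -> skew s (mirror s) = 0.
Proof. by move=> s_r; rewrite /skew mirrorK // subrr. Qed.

Lemma matU_skew i : (1 <= i <= l)%N -> matU R l i = skew 1 (i + l + 1).
Proof. by move=> i_r; rewrite /skew mirror_high. Qed.

Lemma matV_skew i : (1 <= i <= l)%N -> matV R l i = skew 1 (i + 1).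
Proof. by move=> i_r; rewrite /skew mirror_low. Qed.

Lemma matX_skew i j : (1 <= i <= l)%N -> (1 <= j <= l)%N ->
  matX R l i j = skew (i + 1) (j + 1).
Proof. by move=> i_r j_r; rewrite /skew !mirror_low. Qed.

Lemma matY_skew i j : (1 <= i <= l)%N -> (1 <= j <= l)%N ->
  matY R l i j = skew (i + 1) (j + l + 1).
Proof. by move=> i_r j_r; rewrite /skew mirror_high // mirror_low. Qed.

(** In terms of entries, the Lie algebra so is the space of matrices A that
    satisfy A a b = - A b' a', where ' is [mirror]. *)
Lemma skew_entry s t (a b a' b' : 'I_(1 + (l + l))) :
    (1 <= s <= l + l + 1)%N -> (1 <= t <= l + l + 1)%N ->
    a'.+1 = mirror a.+1 -> b'.+1 = mirror b.+1 ->
  skew s t a b = - skew s t b' a'.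
Proof.
move=> s_r t_r a'E b'E; rewrite /skew !mxE a'E b'E opprB.
have in_range (c : 'I_(1 + (l + l))) : (1 <= c.+1 <= l + l + 1)%N.
  by have := ltn_ord c; lia.
rewrite !(@mirror_eq _ _) ?mirror_range // !mirrorK //.
by rewrite [(b.+1 == t) && _]andbC [(b.+1 == mirror s) && _]andbC.
Qed.

Lemma in_so_skew s t :
  (1 <= s <= l + l + 1)%N -> (1 <= t <= l + l + 1)%N -> in_so (skew s t).
Proof.
move=> s_r t_r; have := @skew_entry s t _ _ _ _ s_r t_r.
move: (skew s t) => A skewA.
have first (k : 'I_1) : (lshift (l + l) k).+1 = mirror (lshift (l + l) k).+1.
  by case: k => [[]].
have low (k : 'I_l) :
    (rshift 1 (rshift l k)).+1 = mirror (rshift 1 (lshift l k)).+1.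
  by have := ltn_ord k; rewrite /= /mirror; do 2?case: ifP; lia.
have high (k : 'I_l) :
    (rshift 1 (lshift l k)).+1 = mirror (rshift 1 (rshift l k)).+1.
  by have := ltn_ord k; rewrite /= /mirror; do 2?case: ifP; lia.
exists (rsubmx (ursubmx A)), (lsubmx (ursubmx A)), (ulsubmx (drsubmx A)),
  (ursubmx (drsubmx A)), (dlsubmx (drsubmx A)); split.
- by apply/matrixP=> a b; rewrite !mxE; apply: skewA.
- by apply/matrixP=> a b; rewrite !mxE; apply: skewA.
rewrite -[A in LHS]submxK; congr block_mx.
- apply/matrixP=> a b; rewrite !mxE (ord1 a) (ord1 b).
  have /esym/eqP := skewA _ _ _ _ (first 0) (first 0).
  by rewrite Num.Theory.eqNr => /eqP.
- by rewrite hsubmxK.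
- rewrite -[LHS]vsubmxK; congr col_mx;
    by apply/matrixP=> a b; rewrite !mxE; apply: skewA.
- rewrite -[LHS]submxK; congr block_mx.
  by apply/matrixP=> a b; rewrite !mxE; apply: skewA.
Qed.

End SkewUnits.

(** Evaluates the Kronecker deltas of [bracket_skew], whose indices are linear
    in l, i and j. *)
Ltac decide_deltas :=
  repeat match goal with
  | |- context [(?a == ?b :> nat)] =>
    first [ have -> : (a == b) = false by lia
          | have -> : (a == b) = true by lia ]
  end;
  rewrite /= ?mulr0n ?mulr1n ?scale0r ?scale1r ?subr0 ?addr0 ?sub0r ?add0r.

Section Brackets.
Variables (R : realType) (l : nat).
Implicit Types (i j k : nat).
Notation U := (matU R l).
Notation V := (matV R l).
Notation X := (matX R l).
Notation Y := (matY R l).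

Ltac bracket :=
  rewrite ?matU_skew ?matV_skew ?matX_skew ?matY_skew; try lia;
  rewrite bracket_skew; try lia;
  repeat match goal with
  | |- context [mirror l (?i + l + 1)] => rewrite (@mirror_high l i); [|lia]
  | |- context [mirror l (?i + 1)] => rewrite (@mirror_low l i); [|lia]
  end;
  rewrite ?mirror1; decide_deltas.

Lemma skew11 : skew R l 1 1 = 0.
Proof. by apply: (@skew_mirror R l 1); lia. Qed.

Lemma bracket_X11_V1 : (1 <= l)%N -> lie_bracket (X 1 1) (V 1) = - V 1.
Proof. by move=> l_gt0; bracket. Qed.

Lemma bracket_X11_X i : (2 <= i <= l)%N -> lie_bracket (X 1 1) (X i i) = 0.
Proof. by move=> i_r; bracket. Qed.

Lemma bracket_X11_U i : (2 <= i <= l)%N -> lie_bracket (X 1 1) (U i) = 0.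
Proof. by move=> i_r; bracket. Qed.

Lemma bracket_X11_V i : (2 <= i <= l)%N -> lie_bracket (X 1 1) (V i) = 0.
Proof. by move=> i_r; bracket. Qed.

Lemma bracket_X_U i : (2 <= i <= l)%N -> lie_bracket (X i i) (U i) = U i.
Proof.
move=> i_r; bracket.
by rewrite -skew_swap ?mirror1 ?mirror_low //; lia.
Qed.

Lemma bracket_X_V i : (2 <= i <= l)%N -> lie_bracket (X i i) (V i) = - V i.
Proof. by move=> i_r; bracket. Qed.

Lemma bracket_U_V i : (2 <= i <= l)%N -> lie_bracket (U i) (V i) = - X i i.
Proof.
move=> i_r; bracket.
rewrite skew11 oppr0 add0r -skew_swap ?mirror_low //; lia.
Qed.

Lemma bracket_X11_U1 : (2 <= l)%N -> lie_bracket (X 1 1) (U 1) = U 1.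
Proof.
move=> l_gt1; bracket.
by rewrite -skew_swap ?mirror1 ?mirror_low //; lia.
Qed.

Lemma bracket_X11_X1 j : (2 <= j <= l)%N -> lie_bracket (X 1 1) (X 1 j) = X 1 j.
Proof. by move=> j_r; bracket. Qed.

Lemma bracket_X11_Y1 j : (2 <= j <= l)%N -> lie_bracket (X 1 1) (Y 1 j) = Y 1 j.
Proof. by move=> j_r; bracket. Qed.

Lemma bracket_X_U1 i : (2 <= i <= l)%N -> lie_bracket (X i i) (U 1) = 0.
Proof. by move=> i_r; bracket. Qed.

Lemma bracket_X_X1 i j : (2 <= i <= l)%N -> (2 <= j <= l)%N ->
  lie_bracket (X i i) (X 1 j) = - ((i == j)%:R *: X 1 j).
Proof.
by move=> i_r j_r; have [->|ij] := eqVneq i j; bracket; rewrite ?oppr0.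
Qed.

Lemma bracket_X_Y1 i j : (2 <= i <= l)%N -> (2 <= j <= l)%N ->
  lie_bracket (X i i) (Y 1 j) = (i == j)%:R *: Y 1 j.
Proof.
move=> i_r j_r; have [->|ij] := eqVneq i j; bracket => //.
by rewrite -skew_swap ?(@mirror_high l 1) ?mirror_low //; lia.
Qed.

Lemma bracket_U_U1 i : (2 <= i <= l)%N -> lie_bracket (U i) (U 1) = Y 1 i.
Proof. by move=> i_r; bracket. Qed.

Lemma bracket_U_X1 i j : (2 <= i <= l)%N -> (2 <= j <= l)%N ->
  lie_bracket (U i) (X 1 j) = - ((i == j)%:R *: U 1).
Proof.
by move=> i_r j_r; have [->|ij] := eqVneq i j; bracket; rewrite ?oppr0.
Qed.

Lemma bracket_U_Y1 i j : (2 <= i <= l)%N -> (2 <= j <= l)%N ->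
  lie_bracket (U i) (Y 1 j) = 0.
Proof. by move=> i_r j_r; bracket. Qed.

Lemma bracket_V_U1 i : (2 <= i <= l)%N -> lie_bracket (V i) (U 1) = X 1 i.
Proof. by move=> i_r; bracket. Qed.

Lemma bracket_V_X1 i j : (2 <= i <= l)%N -> (2 <= j <= l)%N ->
  lie_bracket (V i) (X 1 j) = 0.
Proof. by move=> i_r j_r; bracket. Qed.

Lemma bracket_V_Y1 i j : (2 <= i <= l)%N -> (2 <= j <= l)%N ->
  lie_bracket (V i) (Y 1 j) = - ((i == j)%:R *: U 1).
Proof.
by move=> i_r j_r; have [->|ij] := eqVneq i j; bracket; rewrite ?oppr0.
Qed.

Lemma bracket_V1_U1 : (2 <= l)%N -> lie_bracket (V 1) (U 1) = X 1 1.
Proof. by move=> l_gt1; bracket; rewrite skew11 oppr0 add0r. Qed.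

Lemma bracket_V1_X1 j : (2 <= j <= l)%N -> lie_bracket (V 1) (X 1 j) = V j.
Proof. by move=> j_r; bracket. Qed.

Lemma bracket_V1_Y1 j : (2 <= j <= l)%N -> lie_bracket (V 1) (Y 1 j) = U j.
Proof. by move=> j_r; bracket. Qed.

End Brackets.

(** * The variables of C[n] and the operators of the statement *)

Section Operators.
Variables (R : realType) (l : nat).
Hypothesis hl : (2 <= l)%N.
Notation P := {mpoly R[i][nvars l]}.
Implicit Types (i j : nat) (f g : P).

Lemma val_idxX j : (2 <= j <= l)%N -> val (idxX l j) = (j - 1)%N.
Proof. by move=> jl; rewrite /= inordK /nvars; lia. Qed.

Lemma val_idxY j : (2 <= j <= l)%N -> val (idxY l j) = (l + j - 2)%N.
Proof. by move=> jl; rewrite /= inordK /nvars; lia. Qed.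

Lemma idxU_X j : (2 <= j <= l)%N -> (idxU l == idxX l j) = false.
Proof. by move=> jl; rewrite -val_eqE val_idxX //=; lia. Qed.

Lemma idxU_Y j : (2 <= j <= l)%N -> (idxU l == idxY l j) = false.
Proof. by move=> jl; rewrite -val_eqE val_idxY //=; lia. Qed.

Lemma idxX_Y i j : (2 <= i <= l)%N -> (2 <= j <= l)%N ->
  (idxX l i == idxY l j) = false.
Proof. by move=> il jl; rewrite -val_eqE val_idxX // val_idxY //; lia. Qed.

Lemma idxX_U j : (2 <= j <= l)%N -> (idxX l j == idxU l) = false.
Proof. by move=> jl; rewrite eq_sym idxU_X. Qed.

Lemma idxY_U j : (2 <= j <= l)%N -> (idxY l j == idxU l) = false.
Proof. by move=> jl; rewrite eq_sym idxU_Y. Qed.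

Lemma idxY_X i j : (2 <= i <= l)%N -> (2 <= j <= l)%N ->
  (idxY l i == idxX l j) = false.
Proof. by move=> il jl; rewrite eq_sym idxX_Y. Qed.

Lemma idxX_eq i j : (2 <= i <= l)%N -> (2 <= j <= l)%N ->
  (idxX l i == idxX l j) = (i == j).
Proof. by move=> il jl; rewrite -val_eqE !val_idxX //; lia. Qed.

Lemma idxY_eq i j : (2 <= i <= l)%N -> (2 <= j <= l)%N ->
  (idxY l i == idxY l j) = (i == j).
Proof. by move=> il jl; rewrite -val_eqE !val_idxY //; lia. Qed.

Lemma var_cases (Q : 'I_(nvars l) -> Prop) : Q (idxU l) ->
    (forall j, (2 <= j <= l)%N -> Q (idxX l j)) ->
    (forall j, (2 <= j <= l)%N -> Q (idxY l j)) ->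
  forall k, Q k.
Proof.
move=> QU QX QY k; have k_lt : (k < l.-1.*2.+1)%N := ltn_ord k.
have [k0|k_gt0] := posnP k.
  by have -> : k = idxU l by apply: val_inj.
have [kl|lk] := ltnP k l.
  have -> : k = idxX l k.+1.
    by apply: val_inj; rewrite val_idxX /=; lia.
  by apply: QX; lia.
have -> : k = idxY l (k + 2 - l).
  by apply: val_inj; rewrite val_idxY /=; lia.
by apply: QY; lia.
Qed.

Lemma sum_vars (V : nmodType) (F : 'I_(nvars l) -> V) :
  \sum_k F k = F (idxU l) + \sum_(2 <= j < l.+1) (F (idxX l j) + F (idxY l j)).
Proof.
rewrite (eq_bigr (fun k : 'I_(nvars l) => F (inord k))); last first.
  by move=> k _; rewrite inord_val.
rewrite -(big_mkord xpredT (fun k => F (inord k))) big_ltn //.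
congr (_ + _); first by congr F; apply: val_inj; rewrite /= inordK.
rewrite (big_cat_nat _ (n := l)) /nvars /=; try lia.
rewrite big_split /=; congr (_ + _).
  rewrite (big_addn 1 _ 1) subn1 /=.
  by apply: eq_bigr => j _; rewrite /idxX addnK.
have {1}-> : l = (2 + (l - 2))%N by lia.
rewrite (big_addn 2); have -> : ((l.-1).*2.+1 - (l - 2) = l.+1)%N by lia.
apply: eq_big_nat => j jl; congr (F (inord _)); lia.
Qed.

Lemma tX11E f : tX11 f = euler f.
Proof. by rewrite /euler sum_vars. Qed.

(** [lowering k] is the derivation by which the bracket of V_1 with the k-th
    basis element of n acts; the case analysis is that of [nbasis]. *)
Definition lowering (k : 'I_(nvars l)) f : P :=
  if k == 0 :> nat then tX11 f
  else if (k < l)%N then tV k.+1 f else tU (k + 2 - l) f.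

Lemma lowering_U f : lowering (idxU l) f = tX11 f.
Proof. by []. Qed.

Lemma lowering_X j f : (2 <= j <= l)%N -> lowering (idxX l j) f = tV j f.
Proof.
move=> jl; rewrite /lowering /idxX inordK; last by rewrite /nvars; lia.
have -> : (j - 1 == 0)%N = false by lia.
have -> : (j - 1 < l)%N by lia.
by congr (tV _ _); lia.
Qed.

Lemma lowering_Y j f : (2 <= j <= l)%N -> lowering (idxY l j) f = tU j f.
Proof.
move=> jl; rewrite /lowering /idxY inordK; last by rewrite /nvars; lia.
have -> : (l + j - 2 == 0)%N = false by lia.
have -> : (l + j - 2 < l)%N = false by lia.
by congr (tU _ _); lia.
Qed.

Lemma lowering_ind (Q : (P -> P) -> Prop) : Q (@tX11 R l) ->
    (forall j, (2 <= j <= l)%N -> Q (tV j)) ->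
    (forall j, (2 <= j <= l)%N -> Q (tU j)) ->
  (forall D D', D =1 D' -> Q D -> Q D') ->
  forall k, Q (lowering k).
Proof.
move=> Q1 QV QU Qext; apply: var_cases => [//|j jl|j jl].
  by apply: Qext (QV j jl) => f; rewrite lowering_X.
by apply: Qext (QU j jl) => f; rewrite lowering_Y.
Qed.

Lemma derivation_lowering k : derivation (lowering k).
Proof.
apply: lowering_ind => [|j _|j _|]; last exact: derivation_ext.
- apply: derivation_ext (derivation_euler _ _) => f; exact/esym/tX11E.
- exact: derivation_rotation.
- exact: derivation_rotation.
Qed.

Lemma euler_lowering k f : euler (lowering k f) = lowering k (euler f).
Proof.
move: k; apply: (@lowering_ind (fun D => euler (D f) = D (euler f))).
- by rewrite !tX11E.
- by move=> j _; apply: euler_rotation.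
- by move=> j _; apply: euler_rotation.
- by move=> D D' DD'; rewrite !DD'.
Qed.

Lemma pairing_loweringE f g : pairing lowering f g =
  tX11 f * dU g + \sum_(2 <= j < l.+1) (tV j f * dX j g + tU j f * dY j g).
Proof.
rewrite /pairing sum_vars lowering_U.
apply: (f_equal2 +%R); first by [].
by apply: eq_big_nat => j jl; rewrite lowering_X ?lowering_Y.
Qed.

(** The value at a pair of variables is the bracket [[V_1, n_k], n_m], which is
    symmetric in k and m by the Jacobi identity, n being abelian.  In
    coordinates the symmetry holds for each j separately once the sum in tX11 is
    distributed over the sum in the form. *)
Lemma pairing_loweringC f g : pairing lowering f g = pairing lowering g f.
Proof.
have expand p q : pairing lowering p q = varU R l * dU p * dU q
    + \sum_(2 <= j < l.+1)
        ((varX R l j * dX j p + varY R l j * dY j p) * dU q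
         + (tV j p * dX j q + tU j p * dY j q)).
  by rewrite pairing_loweringE [tX11 p * _]mulrDl mulr_suml -addrA -big_split.
rewrite (expand f g) (expand g f).
apply: (f_equal2 +%R); first exact: mulrAC.
(* Generalizing the atoms keeps the ring identity small. *)
apply: eq_bigr => j _; rewrite /tU /tV.
move: (varX R l j) (varY R l j) (varU R l) => x y u.
move: (dU f) (dU g) (dX j f) (dX j g) (dY j f) (dY j g) => f0 g0 fx gx fy gy.
by ring.
Qed.

Lemma contraction_lowering f : contraction lowering f = tV1 f.
Proof.
rewrite /contraction sum_vars lowering_U; congr (_ + _).
by apply: eq_big_nat => j jl; rewrite lowering_X ?lowering_Y.
Qed.

End Operators.

(** * Modules on which n acts by multiplication *)

Section InducedModule.
Variables (R : realType) (l : nat).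
Hypothesis hl : (2 <= l)%N.
Notation C := R[i].
Notation P := {mpoly C[nvars l]}.
Notation mat := 'M[C]_(1 + (l + l)).
Variable act : mat -> P -> P.
Hypothesis act_module : so_module act.
Hypothesis act_Un : forall p f : P, Un_act act p f = p * f.
Implicit Types (A B : mat) (f g : P).

Notation U := (matU R l).
Notation V := (matV R l).
Notation X := (matX R l).
Notation Y := (matY R l).

Lemma in_so_U i : (1 <= i <= l)%N -> in_so (U i).
Proof. by move=> i_r; rewrite matU_skew //; apply: in_so_skew; lia. Qed.

Lemma in_so_V i : (1 <= i <= l)%N -> in_so (V i).
Proof. by move=> i_r; rewrite matV_skew //; apply: in_so_skew; lia. Qed.

Lemma in_so_X i j : (1 <= i <= l)%N -> (1 <= j <= l)%N -> in_so (X i j).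
Proof. by move=> i_r j_r; rewrite matX_skew //; apply: in_so_skew; lia. Qed.

Lemma in_so_Y i j : (1 <= i <= l)%N -> (1 <= j <= l)%N -> in_so (Y i j).
Proof. by move=> i_r j_r; rewrite matY_skew //; apply: in_so_skew; lia. Qed.

Lemma in_so_nbasis (k : 'I_(nvars l)) : in_so (nbasis R k).
Proof.
move: k; apply: (var_cases hl) => [|j jl|j jl].
- by rewrite nbasisU; apply: in_so_U; lia.
- by rewrite nbasisX //; apply: in_so_X; lia.
- by rewrite nbasisY //; apply: in_so_Y; lia.
Qed.

Lemma linear_act A : in_so A -> linear (act A).
Proof. by case: act_module => linr _ _ soA; apply: linr. Qed.

Lemma actZ (c : C) A f : in_so A -> act (c *: A) f = c *: act A f.
Proof.
case: act_module => _ linl _ soA.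
have act0 : act 0 f = 0.
  by have := linl (-1) A A f soA soA; rewrite !scaleN1r !addNr.
have := linl (c - 1) A A f soA soA.
by rewrite -[X in _ *: _ + X]scale1r -[X in _ = _ + X]scale1r -!scalerDl subrK.
Qed.

Lemma act0 f : act 0 f = 0.
Proof.
have soU : in_so (U 1) by apply: in_so_U; lia.
by rewrite -(scale0r (U 1)) actZ // scale0r.
Qed.

Lemma actN A f : in_so A -> act (- A) f = - act A f.
Proof. by move=> soA; rewrite -scaleN1r actZ // scaleN1r. Qed.

Lemma act_bracket A B f : in_so A -> in_so B ->
  act (lie_bracket A B) f = act A (act B f) - act B (act A f).
Proof. by case: act_module => _ _ brk soA soB; apply: brk. Qed.

Lemma act_nbasis (k : 'I_(nvars l)) f : act (nbasis R k) f = 'X_k * f.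
Proof.
rewrite -act_Un /Un_act msuppX big_seq1 mcoeffX eqxx scale1r.
have : k \in enum 'I_(nvars l) by rewrite mem_enum.
elim: (enum _) (enum_uniq 'I_(nvars l)) => //= m s IHs /andP[ms us].
have other : k \notin s ->
    foldr (fun k0 y => iter (U_(k)%MM k0) (act (nbasis R k0)) y) f s = f.
  elim: s {IHs ms us} => //= j s IHs; rewrite inE negb_or mnm1E => /andP[kj ks].
  by rewrite (negPf kj) /= IHs.
rewrite inE mnm1E; have [km _|km ks] /= := eqVneq m k.
  by rewrite -/foldr km other // -km.
exact: IHs.
Qed.

Lemma act_var_mul A k f : in_so A ->
  act A ('X_k * f) = 'X_k * act A f + act (lie_bracket A (nbasis R k)) f.
Proof.
move=> soA; rewrite act_bracket //; last exact: in_so_nbasis.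
by rewrite !act_nbasis addrC subrK.
Qed.

(** A and the operator [D + multiplication by A.1] agree at 1 and have the same
    commutators with the variables. *)
Lemma act_derivation A D : in_so A -> derivation D ->
    (forall k f, act (lie_bracket A (nbasis R k)) f = D 'X_k * f) ->
  forall f, act A f = D f + f * act A 1.
Proof.
move=> soA derD bracketD; have [linD mulD] := derD.
apply: (linear_eq_vars (T := fun f => D f + f * act A 1)).
- exact: linear_act.
- by move=> c f g; rewrite linD mulrDl -scalerAl scalerDr addrACA.
- by rewrite (derivationC _ derD) add0r mul1r.
move=> k f IH.
by rewrite act_var_mul // bracketD IH mulD mulrDr mulrA addrC addrA.
Qed.

Lemma bracket_nbasis A D :
    (forall f, act (lie_bracket A (U 1)) f = D ('X_(idxU l) : P) * f) ->
    (forall j, (2 <= j <= l)%N -> forall f,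
        act (lie_bracket A (X 1 j)) f = D ('X_(idxX l j) : P) * f) ->
    (forall j, (2 <= j <= l)%N -> forall f,
        act (lie_bracket A (Y 1 j)) f = D ('X_(idxY l j) : P) * f) ->
  forall k f, act (lie_bracket A (nbasis R k)) f = D 'X_k * f.
Proof.
move=> HU HX HY; apply: (var_cases hl) => [//|j jl|j jl] f.
  by rewrite nbasisX ?HX.
by rewrite nbasisY ?HY.
Qed.

Lemma act_U1 f : act (U 1) f = 'X_(idxU l) * f.
Proof. by rewrite -nbasisU act_nbasis. Qed.

Lemma act_X1 j f : (2 <= j <= l)%N -> act (X 1 j) f = 'X_(idxX l j) * f.
Proof. by move=> jl; rewrite -nbasisX // act_nbasis. Qed.

Lemma act_Y1 j f : (2 <= j <= l)%N -> act (Y 1 j) f = 'X_(idxY l j) * f.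
Proof. by move=> jl; rewrite -nbasisY // act_nbasis. Qed.

Let range i : (2 <= i <= l)%N -> (1 <= i <= l)%N.
Proof. by lia. Qed.

Let range1 : (1 <= 1 <= l)%N.
Proof. by lia. Qed.

Lemma act_X11 f : act (X 1 1) f = tX11 f + f * act (X 1 1) 1.
Proof.
have soX : in_so (X 1 1) by apply: in_so_X.
rewrite (tX11E hl); apply: act_derivation => //; first exact: derivation_euler.
apply: bracket_nbasis => [g|j jl g|j jl g]; rewrite eulerX.
- by rewrite bracket_X11_U1 // act_U1.
- by rewrite bracket_X11_X1 // act_X1.
- by rewrite bracket_X11_Y1 // act_Y1.
Qed.

Lemma act_X i f : (2 <= i <= l)%N -> act (X i i) f = tX i f + f * act (X i i) 1.
Proof.
move=> il; have soX : in_so (X i i) by apply: in_so_X; apply: range.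
apply: act_derivation => //; first exact: derivation_rotation.
apply: bracket_nbasis => [g|j jl g|j jl g]; rewrite /tX /dX /dY !mderiv_var.
- by rewrite bracket_X_U1 // act0 idxU_X // idxU_Y // !mulr0 subr0 mul0r.
- rewrite bracket_X_X1 // idxX_Y // idxX_eq // mulr0 sub0r.
  have [<-|ij] := eqVneq i j; last first.
    by rewrite scale0r oppr0 act0 mulr0 oppr0 mul0r.
  rewrite scale1r actN ?act_X1 // ?mulr1 ?mulNr //.
  exact: in_so_X (range il).
- rewrite bracket_X_Y1 // idxY_X // idxY_eq // mulr0 subr0.
  have [<-|ij] := eqVneq i j; last by rewrite scale0r act0 mulr0 mul0r.
  by rewrite scale1r act_Y1 // mulr1.
Qed.

Lemma act_U i f : (2 <= i <= l)%N -> act (U i) f = tU i f + f * act (U i) 1.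
Proof.
move=> il; have soU : in_so (U i) by apply: in_so_U; apply: range.
apply: act_derivation => //; first exact: derivation_rotation.
apply: bracket_nbasis => [g|j jl g|j jl g]; rewrite /tU /dU /dX !mderiv_var.
- by rewrite bracket_U_U1 // act_Y1 // eqxx idxU_X // mulr1 mulr0 subr0.
- rewrite bracket_U_X1 // idxX_U // idxX_eq // mulr0 sub0r.
  have [_|ij] := eqVneq i j; last first.
    by rewrite scale0r oppr0 act0 mulr0 oppr0 mul0r.
  rewrite scale1r actN ?act_U1 // ?mulr1 ?mulNr //.
  exact: in_so_U range1.
- by rewrite bracket_U_Y1 // act0 idxY_U // idxY_X // !mulr0 subr0 mul0r.
Qed.

Lemma act_V i f : (2 <= i <= l)%N -> act (V i) f = tV i f + f * act (V i) 1.
Proof.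
move=> il; have soV : in_so (V i) by apply: in_so_V; apply: range.
apply: act_derivation => //; first exact: derivation_rotation.
apply: bracket_nbasis => [g|j jl g|j jl g]; rewrite /tV /dU /dY !mderiv_var.
- by rewrite bracket_V_U1 // act_X1 // eqxx idxU_Y // mulr1 mulr0 subr0.
- by rewrite bracket_V_X1 // act0 idxX_U // idxX_Y // !mulr0 subr0 mul0r.
- rewrite bracket_V_Y1 // idxY_U // idxY_eq // mulr0 sub0r.
  have [_|ij] := eqVneq i j; last first.
    by rewrite scale0r oppr0 act0 mulr0 oppr0 mul0r.
  rewrite scale1r actN ?act_U1 // ?mulr1 ?mulNr //.
  exact: in_so_U range1.
Qed.

(** The obstruction to being a coboundary in degree 0: constant terms of the
    cocycle vanish on brackets, since D_A and D_B have no constant term in their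
    image and the products (A.1)(B.1) cancel. *)
Lemma bracket_const A B (DA DB : P -> P) : in_so A -> in_so B ->
    (forall f, (DA f)@_0%MM = 0 :> C) -> (forall f, (DB f)@_0%MM = 0 :> C) ->
    (forall f, act A f = DA f + f * act A 1) ->
    (forall f, act B f = DB f + f * act B 1) ->
  (act (lie_bracket A B) 1)@_0%MM = 0.
Proof.
move=> soA soB DA0 DB0 actA actB.
rewrite act_bracket // (actA (act B 1)) (actB (act A 1)) mcoeffB !mcoeffD.
by rewrite DA0 DB0 !add0r !mcoeff0M mulrC subrr.
Qed.

(** so(2l-1) is perfect when l >= 2: X_{i,i} = - [U_i, V_i],
    U_i = [X_{i,i}, U_i] and V_i = - [X_{i,i}, V_i]. *)
Lemma act_const i : (2 <= i <= l)%N ->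
  [/\ (act (X i i) 1)@_0%MM = 0, (act (U i) 1)@_0%MM = 0
    & (act (V i) 1)@_0%MM = 0].
Proof.
move=> il; have il1 := range il.
have soX : in_so (X i i) by apply: in_so_X.
have [soU soV] := (in_so_U il1, in_so_V il1).
have X0 f : (tX i f)@_0%MM = 0 by apply: rotation_const.
have U0 f : (tU i f)@_0%MM = 0 by apply: rotation_const.
have V0 f : (tV i f)@_0%MM = 0 by apply: rotation_const.
have actX f := act_X f il; have actU f := act_U f il; have actV f := act_V f il.
split.
- have := bracket_const soU soV U0 V0 actU actV.
  by rewrite bracket_U_V // actN // mcoeffN => /eqP; rewrite oppr_eq0 => /eqP.
- by have := bracket_const soX soU X0 U0 actX actU; rewrite bracket_X_U.
- have := bracket_const soX soV X0 V0 actX actV.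
  by rewrite bracket_X_V // actN // mcoeffN => /eqP; rewrite oppr_eq0 => /eqP.
Qed.

(** As A commutes with X_{1,1}, the cocycle relation between the two is
    E (A.1) = D (X_{1,1}.1), and D commutes with E. *)
Lemma potential A (D : P -> P) Phi (c : C) : in_so A -> derivation D ->
    (forall f, euler (D f) = D (euler f)) ->
    (forall f, (D f)@_0%MM = 0 :> C) ->
    (forall f, act A f = D f + f * act A 1) -> (act A 1)@_0%MM = 0 ->
    lie_bracket (X 1 1) A = 0 -> act (X 1 1) 1 = euler Phi + c%:MP ->
  act A 1 = D Phi.
Proof.
move=> soA derD ED D0 actA A0 bracket0 X11E.
have soX : in_so (X 1 1) by apply: in_so_X.
have cocycle : euler (act A 1) = D (act (X 1 1) 1).
  have := act_bracket 1 soX soA; rewrite bracket0 act0 => /esym/eqP.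
  rewrite subr_eq0 (act_X11 (act A 1)) (actA (act (X 1 1) 1)) (tX11E hl) mulrC.
  by move/eqP; apply: addIr.
apply/eqP; rewrite -subr_eq0; apply/eqP; rewrite [LHS]euler_eq0.
  by rewrite mcoeffB A0 D0 subrr.
rewrite (derivationB (derivation_euler _ _)) cocycle X11E.
by rewrite (derivationD derD) (derivationC _ derD) ED addr0 subrr.
Qed.

Section WithPotential.
Variables (Phi : P) (c : C).
Hypothesis X11E : act (X 1 1) 1 = euler Phi + c%:MP.

Lemma levi_potential i : (2 <= i <= l)%N ->
  [/\ act (X i i) 1 = tX i Phi, act (U i) 1 = tU i Phi
    & act (V i) 1 = tV i Phi].
Proof.
move=> il; have il1 := range il; have [X0 U0 V0] := act_const il.
split; apply: potential X11E => //.
- exact: in_so_X.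
- exact: derivation_rotation.
- exact: euler_rotation.
- exact: rotation_const.
- by move=> f; apply: act_X.
- exact: bracket_X11_X.
- exact: in_so_U.
- exact: derivation_rotation.
- exact: euler_rotation.
- exact: rotation_const.
- by move=> f; apply: act_U.
- exact: bracket_X11_U.
- exact: in_so_V.
- exact: derivation_rotation.
- exact: euler_rotation.
- exact: rotation_const.
- by move=> f; apply: act_V.
- exact: bracket_X11_V.
Qed.

(** [V_1, n_k] is X_{1,1}, V_j or U_j, whose actions are known by now. *)
Lemma act_bracket_V1 k f : act (lie_bracket (V 1) (nbasis R k)) f =
  lowering k f + f * (lowering k Phi + (k == idxU l)%:R * c%:MP).
Proof.
have drop0 (p q : P) : p + false%:R * q = p by rewrite mul0r addr0.
move: k; apply: (var_cases hl) => [|j jl|j jl].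
- rewrite nbasisU bracket_V1_U1 // act_X11 X11E (tX11E hl) eqxx mul1r.
  by rewrite !lowering_U !(tX11E hl).
- rewrite nbasisX // bracket_V1_X1 // act_V // !lowering_X // idxX_U //.
  have [_ _ ->] := levi_potential jl.
  exact: (congr1 (fun p => tV j f + f * p) (esym (drop0 _ _))).
rewrite nbasisY // bracket_V1_Y1 // act_U // !lowering_Y // idxY_U //.
have [_ -> _] := levi_potential jl.
exact: (congr1 (fun p => tU j f + f * p) (esym (drop0 _ _))).
Qed.

Lemma act_V1_1 : act (V 1) 1 =
  2^-1 *: (pairing (@lowering R l) Phi Phi + tV1 Phi + (2 * c) *: dU Phi).
Proof.
have l_gt0 : (1 <= l)%N by lia.
have [soX soV] := (in_so_X range1 range1, in_so_V range1).
rewrite -contraction_lowering //.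
apply: (second_order_at1 (j := idxU l) (derivation_lowering R hl)
  (euler_lowering hl) (pairing_loweringC hl) (linear_act soV)) => [k f|].
  by rewrite act_var_mul // act_bracket_V1 addrA.
have := act_bracket 1 soX soV; rewrite bracket_X11_V1 // actN //.
rewrite (act_X11 (act (V 1) 1)) (tX11E hl) X11E => weight.
have shift (p q r : P) : p - q = - r -> q = p + r.
  by move=> pqr; rewrite -[r]opprK -pqr opprB addrC subrK.
exact: shift (esym weight).
Qed.

End WithPotential.

End InducedModule.

Theorem lemma3p2 (R : realType) (l : nat) (hl : (2 <= l)%N)
    (act : 'M[R[i]]_(1 + (l + l)) ->
           {mpoly R[i][nvars l]} -> {mpoly R[i][nvars l]})
    (act_module : so_module act)
    (act_Un : forall p f : {mpoly R[i][nvars l]}, Un_act act p f = p * f) :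
  exists (Phi : {mpoly R[i][nvars l]}) (C : R[i]),
    [/\ act (matX R l 1 1) 1 = tX11 Phi + C%:MP,
        forall i : nat, (2 <= i <= l)%N ->
          [/\ act (matX R l i i) 1 = tX i Phi,
              act (matU R l i) 1 = tU i Phi &
              act (matV R l i) 1 = tV i Phi] &
        act (matV R l 1) 1 =
          2^-1 *: (tX11 Phi * dU Phi
                   + \sum_(2 <= j < l.+1)
                       (tV j Phi * dX j Phi + tU j Phi * dY j Phi)
                   + tV1 Phi + (2 * C) *: dU Phi)].
Proof.
have [Phi X11E] := euler_onto (act (matX R l 1 1) 1).
exists Phi, (act (matX R l 1 1) 1)@_0%MM; split.
- by rewrite tX11E.
- move=> i il; exact: (levi_potential hl act_module act_Un X11E).
- by rewrite -pairing_loweringE //; apply: act_V1_1.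
Qed.
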